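(* Let $S$ be a ring. Let $P_S$ be a countably generated projective right $S$-module with trace ideal $I$. Let $Q_1$ and $Q_2$ be countably generated projective right $S$-modules, and let $Y$ be a right $S/I$-module. Then $Q_1/Q_1I\oplus Y\cong Q_2/Q_2I$ (as right $S/I$-modules) if and only if there exists a countably generated projective right $S$-module $P'$ such that $P'/P'I\cong Y$ and $Q_1\oplus P'\oplus P^{(\omega)}\cong Q_2\oplus P^{(\omega)}$.
   Context: Rings are associative with $1$, not necessarily commutative. For a projective right $S$-module $P$, its trace ideal is the two-sided ideal $\sum_{f\in\mathrm{Hom}_S(P,S)}f(P)$ of $S$. $P^{(\omega)}$ denotes the direct sum of countably infinitely many copies of $P$. *)

(* Defs.v *)
From HB Require Import structures.
From mathcomp Require Import all_boot all_algebra.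
From mathcomp Require Import boolp functions.

Set Implicit Arguments.
Unset Strict Implicit.
Unset Printing Implicit Defensive.

Import GRing.Theory.
Local Open Scope ring_scope.
Local Open Scope quotient_scope.

(* A right S-module is a left module over the converse ring S^c: for q in such
   a module and s in S, the right action q.s is written s *: q.  All rings are
   [pzRingType]s, because S/I is the zero ring when I = S. *)
Notation rmodType S := (lmodType S^c) (only parsing).

(* S as a right module over itself: s *: x = x * s in S. *)
Notation regular_rmod S := ((S^c)^o).

Section Modules.
Variable R : pzRingType.
Implicit Types M N P : lmodType R.

Definition lmod_isom M N : Prop := exists f : {linear M -> N}, bijective f.

Definition projective P : Prop :=
  forall M N (g : {linear M -> N}) (f : {linear P -> N}),
    (forall y, exists x, g x = y) ->
    exists h : {linear P -> M}, forall x, g (h x) = f x.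

(* Finite generating sets are covered by repeating generators. *)
Definition countably_generated M : Prop :=
  exists e : nat -> M, forall x, exists (n : nat) (c : 'I_n -> R),
    x = \sum_(i < n) c i *: e i.

Definition finite_support M : {pred (nat -> M)} :=
  fun u => `[< exists n : nat, forall k : nat, (n <= k)%N -> u k = 0 >].

Lemma finite_support_submod M : submod_closed (@finite_support M).
Proof.
split=> [|a u v /asboolP[m um] /asboolP[n vn]]; apply/asboolP; first by exists 0%N.
exists (maxn m n) => k; rewrite geq_max => /andP[mk nk].
have -> : (a *: u + v) k = a *: u k + v k by [].
by rewrite um // vn // scaler0 addr0.
Qed.

HB.instance Definition _ M :=
  GRing.isSubmodClosed.Build R (nat -> M) (@finite_support M)
    (@finite_support_submod M).

(* The direct sum of countably many copies of M, as finitely supported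
   sequences with pointwise operations. *)
Record omega_sum M := OmegaSum {
  omega_val :> nat -> M;
  _ : omega_val \in @finite_support M
}.

HB.instance Definition _ M := [isSub for @omega_val M].
HB.instance Definition _ M := [Choice of omega_sum M by <:].
HB.instance Definition _ M := [SubChoice_isSubZmodule of omega_sum M by <:].
HB.instance Definition _ M := [SubZmodule_isSubLmodule of omega_sum M by <:].

End Modules.

Record ideal (S : pzRingType) := Ideal {
  ideal_pred :> {pred S};
  ideal_zmod_closed : zmod_closed ideal_pred;
  idealMl : forall s x : S, x \in ideal_pred -> s * x \in ideal_pred;
  idealMr : forall s x : S, x \in ideal_pred -> x * s \in ideal_pred
}.

HB.instance Definition _ (S : pzRingType) (I : ideal S) :=
  GRing.isZmodClosed.Build S (ideal_pred I) (ideal_zmod_closed I).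

Section RingQuotient.
Variables (S : pzRingType) (I : ideal S).

Definition ring_quot : Type := Quotient.quot (ideal_pred I).
HB.instance Definition _ := GRing.Zmodule.on ring_quot.
HB.instance Definition _ := EqQuotient.on ring_quot.

Definition ring_quot_one : ring_quot := \pi_ring_quot (1 : S).
Definition ring_quot_mul (x y : ring_quot) : ring_quot :=
  \pi_ring_quot (repr x * repr y).

Lemma ring_quot_eqP (x y : S) :
  reflect (\pi_ring_quot x = \pi_ring_quot y) (x - y \in ideal_pred I).
Proof. by rewrite (Quotient.idealrBE (ideal_pred I)); exact: eqP. Qed.

Lemma ring_quot_repr (x : S) : repr (\pi_ring_quot x) - x \in ideal_pred I.
Proof. by apply/ring_quot_eqP; rewrite reprK. Qed.

Lemma ring_quot_piD (x y : S) :
  \pi_ring_quot (x + y) = \pi_ring_quot x + \pi_ring_quot y.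
Proof. exact: (raddfD (\pi_ring_quot : {additive S -> ring_quot})). Qed.

Lemma ring_quot_piM (x y : S) :
  \pi_ring_quot (x * y) = ring_quot_mul (\pi_ring_quot x) (\pi_ring_quot y).
Proof.
apply/esym/ring_quot_eqP.
set x' := repr _; set y' := repr _.
have -> : x' * y' - x * y = (x' - x) * y' + x * (y' - y).
  by rewrite mulrBl mulrBr addrA subrK.
apply: (@rpredD _ (ideal_pred I)); [apply: idealMr|apply: idealMl];
  exact: ring_quot_repr.
Qed.

Fact ring_quot_mulA : associative ring_quot_mul.
Proof.
elim/quotW=> x; elim/quotW=> y; elim/quotW=> z.
by rewrite -(ring_quot_piM y z) -(ring_quot_piM x y) -(ring_quot_piM x (y * z))
  -(ring_quot_piM (x * y) z) mulrA.
Qed.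

Fact ring_quot_mul1l : left_id ring_quot_one ring_quot_mul.
Proof. by elim/quotW=> x; rewrite -(ring_quot_piM 1 x) mul1r. Qed.

Fact ring_quot_mul1r : right_id ring_quot_one ring_quot_mul.
Proof. by elim/quotW=> x; rewrite -(ring_quot_piM x 1) mulr1. Qed.

Fact ring_quot_mulDl : left_distributive ring_quot_mul +%R.
Proof.
elim/quotW=> x; elim/quotW=> y; elim/quotW=> z.
by rewrite -(ring_quot_piM x z) -(ring_quot_piM y z) -(ring_quot_piD x y)
  -(ring_quot_piM (x + y) z) -(ring_quot_piD (x * z)) mulrDl.
Qed.

Fact ring_quot_mulDr : right_distributive ring_quot_mul +%R.
Proof.
elim/quotW=> x; elim/quotW=> y; elim/quotW=> z.
by rewrite -(ring_quot_piM x y) -(ring_quot_piM x z) -(ring_quot_piD y z)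
  -(ring_quot_piM x (y + z)) -(ring_quot_piD (x * y)) mulrDr.
Qed.

HB.instance Definition _ := GRing.Zmodule_isPzRing.Build ring_quot
  ring_quot_mulA ring_quot_mul1l ring_quot_mul1r
  ring_quot_mulDl ring_quot_mulDr.

End RingQuotient.

Section ModuleQuotient.
Variables (S : pzRingType) (I : ideal S) (Q : rmodType S).

(* QI, the set of finite sums of elements q.a with q in Q and a in I. *)
Definition mod_mul_ideal : {pred Q} := fun x =>
  `[< exists (n : nat) (q : 'I_n -> Q) (a : 'I_n -> S),
        (forall i, a i \in ideal_pred I) /\
        x = \sum_(i < n) (a i : S^c) *: q i >].

Lemma mod_mul_idealZ (a : S) (q : Q) :
  a \in ideal_pred I -> (a : S^c) *: q \in mod_mul_ideal.
Proof.
move=> aI; apply/asboolP; exists 1%N, (fun=> q), (fun=> a); split=> //.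
by rewrite big_ord1.
Qed.

Lemma mod_mul_ideal_submod : submod_closed mod_mul_ideal.
Proof.
split=> [|s x y].
  by apply/asboolP; exists 0%N, (fun=> 0), (fun=> 0); split=> [[]//|];
    rewrite big_ord0.
move=> /asboolP[m [q [a [aI ->]]]] /asboolP[n [r [b [bI ->]]]].
apply/asboolP; exists (m + n)%N,
  (fun i => match fintype.split i with inl j => q j | inr j => r j end),
  (fun i => match fintype.split i with inl j => a j * (s : S) | inr j => b j end).
split=> [i|]; first by case: (fintype.split i) => j; rewrite ?idealMr.
rewrite big_split_ord /= scaler_sumr; congr (_ + _); apply: eq_bigr => i _.
  by rewrite (unsplitK (inl i)) scalerA.
by rewrite (unsplitK (inr i)).
Qed.

HB.instance Definition _ :=
  GRing.isSubmodClosed.Build S^c Q mod_mul_ideal mod_mul_ideal_submod.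

Definition mod_quot : Type := Quotient.quot mod_mul_ideal.
HB.instance Definition _ := GRing.Zmodule.on mod_quot.
HB.instance Definition _ := EqQuotient.on mod_quot.

Lemma mod_quot_eqP (x y : Q) :
  reflect (\pi_mod_quot x = \pi_mod_quot y) (x - y \in mod_mul_ideal).
Proof. by rewrite (Quotient.idealrBE mod_mul_ideal); exact: eqP. Qed.

Lemma mod_quot_repr (x : Q) : repr (\pi_mod_quot x) - x \in mod_mul_ideal.
Proof. by apply/mod_quot_eqP; rewrite reprK. Qed.

Lemma mod_quot_piD (x y : Q) :
  \pi_mod_quot (x + y) = \pi_mod_quot x + \pi_mod_quot y.
Proof. exact: (raddfD (\pi_mod_quot : {additive Q -> mod_quot})). Qed.

Definition mod_quot_scale (a : (ring_quot I)^c) (x : mod_quot) : mod_quot :=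
  \pi_mod_quot ((repr (a : ring_quot I) : S^c) *: repr x).

Lemma mod_quot_scale_pi (a : S) (x : Q) :
  mod_quot_scale (\pi_(ring_quot I) a) (\pi_mod_quot x) =
  \pi_mod_quot ((a : S^c) *: x).
Proof.
apply/mod_quot_eqP; set a' : S^c := repr _; set x' := repr _.
have -> : a' *: x' - (a : S^c) *: x
    = (a' - (a : S^c)) *: x' + (a : S^c) *: (x' - x).
  by rewrite scalerBl scalerBr addrA subrK.
apply: (@rpredD _ mod_mul_ideal).
  exact/mod_mul_idealZ/ring_quot_repr.
exact/rpredZ/mod_quot_repr.
Qed.

Fact mod_quot_scaleA (a b : (ring_quot I)^c) (x : mod_quot) :
  mod_quot_scale a (mod_quot_scale b x) = mod_quot_scale (a * b) x.
Proof.
elim/quotW: x => x; elim/(@quotW _ (ring_quot I)): a => a.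
elim/(@quotW _ (ring_quot I)): b => b.
rewrite (mod_quot_scale_pi b) (mod_quot_scale_pi a) scalerA.
rewrite -(mod_quot_scale_pi (b * a)); congr mod_quot_scale.
exact: ring_quot_piM.
Qed.

Fact mod_quot_scale1 : left_id 1 mod_quot_scale.
Proof.
by elim/quotW=> x; rewrite (mod_quot_scale_pi 1 x) scale1r.
Qed.

Fact mod_quot_scaleDr : right_distributive mod_quot_scale +%R.
Proof.
elim/(@quotW _ (ring_quot I))=> a; elim/quotW=> x; elim/quotW=> y.
by rewrite -(mod_quot_piD x y) !mod_quot_scale_pi -mod_quot_piD scalerDr.
Qed.

Fact mod_quot_scaleDl (x : mod_quot) :
  {morph mod_quot_scale^~ x : a b / a + b}.
Proof.
elim/quotW: x => x; elim/(@quotW _ (ring_quot I))=> a.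
elim/(@quotW _ (ring_quot I))=> b.
rewrite (mod_quot_scale_pi a) (mod_quot_scale_pi b) -mod_quot_piD -scalerDl.
rewrite -(mod_quot_scale_pi (a + b)); congr mod_quot_scale.
by rewrite ring_quot_piD.
Qed.

HB.instance Definition _ :=
  GRing.Zmodule_isLmodule.Build (ring_quot I)^c mod_quot
    mod_quot_scaleA mod_quot_scale1 mod_quot_scaleDr mod_quot_scaleDl.

End ModuleQuotient.

Section Trace.
Variables (S : pzRingType) (P : rmodType S).

Definition trace_pred : {pred S} := fun x =>
  `[< exists (n : nat) (f : 'I_n -> {linear P -> regular_rmod S})
        (p : 'I_n -> P), x = \sum_(i < n) f i (p i) >].

Fact trace_zmod_closed : zmod_closed trace_pred.
Proof.
split=> [|x y].
  apply/asboolP; exists 0%N.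
  by exists (fun=> \0 : {linear P -> regular_rmod S}), (fun=> 0); rewrite big_ord0.
move=> /asboolP[m [f [p ->]]] /asboolP[n [g [q ->]]].
apply/asboolP; exists (m + n)%N,
  (fun i => match fintype.split i with inl j => f j | inr j => g j end),
  (fun i => match fintype.split i with inl j => p j | inr j => - q j end).
rewrite big_split_ord /= -sumrN; congr (_ + _); apply: eq_bigr => i _.
  by rewrite (unsplitK (inl i)).
by rewrite (unsplitK (inr i)) linearN.
Qed.

Definition lmul_hom (s : S) (f : {linear P -> regular_rmod S})
  (p : P) : regular_rmod S := s * (f p : S).

Fact lmul_hom_linear s f : linear (lmul_hom s f).
Proof.
move=> a p q; rewrite /lmul_hom linearP.
have E (b : S^c) (x : regular_rmod S) : b *: x = (x : S) * (b : S) by [].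
by rewrite !E [LHS]mulrDr mulrA.
Qed.

HB.instance Definition _ s f := GRing.isLinear.Build S^c P (regular_rmod S)
  *:%R (lmul_hom s f) (lmul_hom_linear s f).

Fact trace_idealMl (s x : S) : x \in trace_pred -> s * x \in trace_pred.
Proof.
move=> /asboolP[n [f [p ->]]]; apply/asboolP.
by exists n, (fun i => lmul_hom s (f i)), p; rewrite mulr_sumr.
Qed.

Fact trace_idealMr (s x : S) : x \in trace_pred -> x * s \in trace_pred.
Proof.
move=> /asboolP[n [f [p ->]]]; apply/asboolP.
exists n, f, (fun i => (s : S^c) *: p i); rewrite mulr_suml.
by apply: eq_bigr => i _; rewrite linearZ.
Qed.

Definition trace_ideal : ideal S :=
  Ideal trace_zmod_closed trace_idealMl trace_idealMr.

End Trace.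

(* Main.v *)
Require Import Defs.
From HB Require Import structures.
From mathcomp Require Import all_boot all_algebra.
From mathcomp Require Import boolp functions.

(** Write I for the trace ideal of P and P^w for the countable direct sum of
    copies of P.

    Two facts about I carry the proof.  First, P = PI, since by the dual basis
    lemma every x in P is a finite sum of terms e_i.f_i(x) with f_i(x) in I;
    hence P^w = P^w.I ([trace_mul_omega_sum]) and adding P^w to a module does
    not change its reduction modulo I.  Second, for every module M each element
    of MI is a finite sum of values of homomorphisms P -> M, namely of
    p |-> m.f(p).  So if M is countably generated and g : N -> M is onto modulo
    MI, then a single homomorphism H : P^w -> M makes g + H onto
    ([trace_cover]).

    From right to left the claim is then obtained by reducing the given
    isomorphism modulo I.

    From left to right, the composite Q2/Q2I -> Q1/Q1I + Y -> Q1/Q1I lifts to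
    g : Q2 -> Q1 because Q2 is projective.  It is onto modulo Q1I, so some
    G = g + H : Q2 + P^w -> Q1 is onto, and it splits because Q1 is projective.
    Let P' be the kernel of G.  It is a direct summand of Q2 + P^w, hence
    countably generated and projective, and Q1 + P' is isomorphic to Q2 + P^w.
    As the sequence P' -> Q2 + P^w -> Q1 splits, it stays exact modulo I, where
    it identifies P'/P'I with the kernel of Q1/Q1I + Y -> Q1/Q1I, that is with
    Y ([reduction_kernel]).  Adding one more copy of P^w and using
    P^w + P^w = P^w gives the required isomorphism.

    Reductions are handled through the property that determines them: a
    surjection from M onto an S/I-module, linear over S, with kernel MI
    ([is_reduction]).  Any two targets of such surjections are isomorphic over
    S/I ([reduction_unique]), so no functoriality of M/MI is set up. *)

Set Implicit Arguments.
Unset Strict Implicit.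
Unset Printing Implicit Defensive.

Import GRing.Theory.
Local Open Scope ring_scope.
Local Open Scope quotient_scope.

(** * Linear maps, binary sums and countable generation *)

Section LinearMaps.
Variable R : pzRingType.
Implicit Types M N : lmodType R.

(** Bundles a function with a proof of its linearity in one step, so that the
    maps built inside proofs need no declaration of their own. *)
Lemma linear_ex M N (f : M -> N) :
  linear f -> exists g : {linear M -> N}, g =1 f.
Proof.
move=> fL; pose m := GRing.isLinear.Build R M N *:%R f fL.
pose g : {linear M -> N} := HB.pack f m.
by exists g.
Qed.

Lemma linear_inverse M N (f : {linear M -> N}) (g : N -> M) :
  cancel f g -> cancel g f -> exists g' : {linear N -> M}, g' =1 g.
Proof.
move=> fK gK; apply: linear_ex => a x y.
by apply: (can_inj fK); rewrite linearP !gK.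
Qed.

Lemma lmod_isom_sym M N : lmod_isom M N -> lmod_isom N M.
Proof.
case=> f [g fK gK]; have [g' g'E] := linear_inverse fK gK.
by exists g', f => x; rewrite g'E.
Qed.

Lemma lmod_isom_trans M N (L : lmodType R) :
  lmod_isom M N -> lmod_isom N L -> lmod_isom M L.
Proof.
move=> [f fb] [g gb].
by exists (g \o f : {linear M -> L}); apply: bij_comp.
Qed.

Lemma lmod_isom_prod M M' N N' :
  lmod_isom M M' -> lmod_isom N N' -> lmod_isom (M * N)%type (M' * N')%type.
Proof.
move=> [f [f' fK f'K]] [g [g' gK g'K]].
have hL : linear (fun x : M * N => (f x.1, g x.2)).
  by move=> a x y; rewrite !linearP.
have [h hE] := linear_ex hL; exists h, (fun x => (f' x.1, g' x.2)).
  by case=> x y; rewrite hE /= fK gK.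
by case=> x y; rewrite hE /= f'K g'K.
Qed.

Lemma lmod_isom_prodA M N (L : lmodType R) :
  lmod_isom (M * N * L)%type (M * (N * L))%type.
Proof.
have hL : linear (fun x : M * N * L => (x.1.1, (x.1.2, x.2))) by [].
have [h hE] := linear_ex hL.
exists h, (fun x => ((x.1, x.2.1), x.2.2)).
  by case=> [[x y] z]; rewrite hE.
by case=> [x [y z]]; rewrite hE.
Qed.

Lemma lmod_isom_refl M : lmod_isom M M.
Proof. by exists (idfun : {linear M -> M}), id. Qed.

Lemma inj_surj_lmod_isom M N (f : {linear M -> N}) :
  (forall x, f x = 0 -> x = 0) -> (forall y, exists x, f x = y) ->
  lmod_isom M N.
Proof.
move=> f_inj f_surj; exists f; have [g fg] := choice f_surj.
exists g => // x; apply/eqP; rewrite -subr_eq0; apply/eqP/f_inj.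
by rewrite linearB fg subrr.
Qed.

Lemma prod_case M N (L : lmodType R)
    (f : {linear M -> L}) (g : {linear N -> L}) :
  exists h : {linear (M * N)%type -> L}, forall x, h x = f x.1 + g x.2.
Proof.
have hL : linear (fun x : M * N => f x.1 + g x.2).
  by move=> a x y; rewrite !linearP scalerDr addrACA.
by have [h hE] := linear_ex hL; exists h.
Qed.

Definition prod_inl M N (x : M) : (M * N)%type := (x, 0).
Definition prod_inr M N (y : N) : (M * N)%type := (0, y).

Fact prod_inl_linear M N : linear (@prod_inl M N).
Proof. by move=> a x y; congr pair; rewrite /= scaler0 addr0. Qed.

Fact prod_inr_linear M N : linear (@prod_inr M N).
Proof. by move=> a x y; congr pair; rewrite /= scaler0 addr0. Qed.

HB.instance Definition _ M N := GRing.isLinear.Build R M (M * N)%type *:%R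
  (@prod_inl M N) (@prod_inl_linear M N).
HB.instance Definition _ M N := GRing.isLinear.Build R N (M * N)%type *:%R
  (@prod_inr M N) (@prod_inr_linear M N).

Lemma prod_inlr M N (x : M) (y : N) : (x, y) = prod_inl N x + prod_inr M y.
Proof. by congr pair; rewrite /= ?addr0 ?add0r. Qed.

Lemma projective_retract M N (i : {linear N -> M}) (r : {linear M -> N}) :
  (forall x, r (i x) = x) -> projective M -> projective N.
Proof.
move=> ri Mproj A B g f gs.
have [h hE] := Mproj A B g (f \o r : {linear M -> B}) gs.
by exists (h \o i : {linear N -> A}) => x; rewrite /= hE /= ri.
Qed.

Lemma projective_prod M N :
  projective M -> projective N -> projective (M * N)%type.
Proof.
move=> Mproj Nproj A B g f gs.
have [h1 h1E] := Mproj A B g (f \o @prod_inl M N : {linear M -> B}) gs.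
have [h2 h2E] := Nproj A B g (f \o @prod_inr M N : {linear N -> B}) gs.
have [h hE] := prod_case h1 h2; exists h => -[x y].
by rewrite hE linearD h1E h2E /= -linearD -prod_inlr.
Qed.

(** Countable generation as an induction principle: a submodule containing the
    generators is everything.  Together with the converse below, it replaces
    the manipulation of coefficient families in all later closure results. *)
Lemma countably_generated_submod M : countably_generated M ->
  exists e : nat -> M, forall A : {pred M}, submod_closed A ->
    (forall i, e i \in A) -> forall x, x \in A.
Proof.
case=> e eP; exists e => A [A0 AD] Ae x; have [n [c ->]] := eP x.
elim: n c => [|n IH] c; first by rewrite big_ord0.
by rewrite big_ord_recr /= addrC; apply: AD => //; apply: IH.
Qed.

(** The generators may be indexed by any countable type: they are listed along
    [unpickle], with 0 in the unused places, and the linear combinations of the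
    list form a submodule. *)
Lemma submod_countably_generated M (T : countType) (e : T -> M) :
  (forall A : {pred M}, submod_closed A -> (forall t, e t \in A) ->
    forall x, x \in A) -> countably_generated M.
Proof.
move=> eP; pose e' n := if unpickle n is Some t then e t else 0.
exists e'.
pose A : {pred M} := fun x => `[< exists (n : nat) (c : nat -> R),
  x = \sum_(i < n) c i *: e' i >].
(* Padding the coefficients with zeros allows a common length for two sums. *)
have A_pad x : x \in A -> exists n, exists c : nat -> R, forall m, (n <= m)%N ->
    x = \sum_(i < m) c i *: e' i.
  move=> /asboolP[n [c ->]].
  exists n, (fun i => if (i < n)%N then c i else 0) => m nm.
  rewrite (big_ord_widen m (fun i => c i *: e' i) nm) big_mkcond /=.
  by apply: eq_bigr => i _; case: ifP => // _; rewrite scale0r.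
have A_closed : submod_closed A.
  split=> [|a x y].
    by apply/asboolP; exists 0%N, (fun=> 0); rewrite big_ord0.
  move=> /A_pad[m [c cE]] /A_pad[n [d dE]].
  apply/asboolP; exists (maxn m n), (fun i => a * c i + d i).
  rewrite (cE (maxn m n)) ?leq_maxl // (dE (maxn m n)) ?leq_maxr //.
  rewrite scaler_sumr -big_split; apply: eq_bigr => i _.
  by rewrite scalerDl scalerA.
have A_e t : e t \in A.
  apply/asboolP; exists (pickle t).+1, (fun i => (i == pickle t)%:R).
  rewrite big_ord_recr /= eqxx scale1r /e' pickleK big1 ?add0r // => i _.
  by rewrite ltn_eqF // scale0r.
move=> x; have /asboolP[n [c ->]] := eP A A_closed A_e x.
by exists n, (fun i => c i).
Qed.

Lemma submod_closed_preim M N (f : {linear M -> N}) (A : {pred N}) :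
  submod_closed A -> submod_closed [pred x | f x \in A].
Proof.
case=> A0 AD; split; first by rewrite inE linear0.
by move=> a x y; rewrite !inE linearP; apply: AD.
Qed.

Lemma countably_generated_image M N (f : {linear M -> N}) :
  (forall y, exists x, f x = y) ->
  countably_generated M -> countably_generated N.
Proof.
move=> fs /countably_generated_submod[e eP].
apply: (@submod_countably_generated N nat (f \o e)) => A Acl Ae y.
have [x <-] := fs y.
by have := eP _ (submod_closed_preim f Acl) Ae x.
Qed.

Lemma countably_generated_prod M N : countably_generated M ->
  countably_generated N -> countably_generated (M * N)%type.
Proof.
move=> /countably_generated_submod[e eP] /countably_generated_submod[d dP].
pose ed (t : nat + nat) : M * N :=
  match t with inl i => prod_inl N (e i) | inr i => prod_inr M (d i) end.
apply: (submod_countably_generated (e := ed)) => A Acl Aed [x y].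
have Ax := eP _ (submod_closed_preim (@prod_inl M N) Acl)
  (fun i => Aed (inl i)) x.
have Ay := dP _ (submod_closed_preim (@prod_inr M N) Acl)
  (fun i => Aed (inr i)) y.
by case: Acl => _ AD; rewrite prod_inlr -[prod_inl N x]scale1r AD.
Qed.

End LinearMaps.

(** * The countable direct sum *)

Section OmegaSum.
Variable R : pzRingType.
Implicit Types M N : lmodType R.

Fact omega_inj_subproof M (k : nat) (x : M) :
  (fun i => if i == k then x else 0) \in @finite_support R M.
Proof.
apply/asboolP; exists k.+1 => i ki; case: eqP => // ik.
by rewrite ik ltnn in ki.
Qed.

Definition omega_inj M k x : omega_sum M := OmegaSum (omega_inj_subproof k x).

Lemma omega_sum_eq M (u v : omega_sum M) : u =1 v -> u = v.
Proof. by move=> uv; apply: val_inj; apply: funext. Qed.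

Lemma omega_sum_coordP M (a : R) (u v : omega_sum M) k :
  (a *: u + v) k = a *: u k + v k.
Proof. by []. Qed.

Fact omega_inj_linear M k : linear (@omega_inj M k).
Proof.
move=> a x y; apply: omega_sum_eq => i; rewrite omega_sum_coordP /=.
by case: ifP => // _; rewrite scaler0 addr0.
Qed.

HB.instance Definition _ M k := GRing.isLinear.Build R M (omega_sum M) *:%R
  (@omega_inj M k) (@omega_inj_linear M k).

Lemma omega_sum_support M (u : omega_sum M) :
  exists n, forall k, (n <= k)%N -> u k = 0.
Proof. exact: asboolW (valP u). Qed.

Lemma omega_sum_coord_sum M n (F : 'I_n -> omega_sum M) k :
  (\sum_(i < n) F i) k = \sum_(i < n) F i k.
Proof.
exact: (big_morph (fun u : omega_sum M => u k)).
Qed.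

Lemma omega_sum_expand M (u : omega_sum M) :
  exists n, u = \sum_(i < n) omega_inj i (u i).
Proof.
have [n un] := omega_sum_support u; exists n; apply: omega_sum_eq => k.
rewrite omega_sum_coord_sum /=.
have [nk|kn] := leqP n k.
  rewrite un // big1 // => i _; case: eqP => // ki.
  by move: nk; rewrite ki leqNgt ltn_ord.
rewrite (bigD1 (Ordinal kn)) //= eqxx big1 ?addr0 // => i ik.
by case: eqP => // ki; case/eqP: ik; exact: val_inj.
Qed.

Lemma omega_sum_submod M (A : {pred omega_sum M}) : submod_closed A ->
  (forall k x, omega_inj k x \in A) -> forall u, u \in A.
Proof.
move=> [A0 AD] Ainj u; have [n ->] := omega_sum_expand u.
elim: n => [|n IH]; first by rewrite big_ord0.
by rewrite big_ord_recr /= -[X in X + _]scale1r; apply: AD.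
Qed.

(** The universal property of the direct sum.  The value at [u] is the sum of
    the [h i (u i)] up to a chosen bound for the support of [u]; any larger
    bound gives the same sum, which is what makes the map linear. *)
Lemma omega_lift M N (h : nat -> {linear M -> N}) :
  exists H : {linear omega_sum M -> N}, forall k x, H (omega_inj k x) = h k x.
Proof.
have [b bP] := choice (@omega_sum_support M).
pose H (u : omega_sum M) := \sum_(i < b u) h i (u i).
have HE (u : omega_sum M) m : (forall k, (m <= k)%N -> u k = 0) ->
    H u = \sum_(i < m) h i (u i).
  have widen p q : (p <= q)%N -> (forall k, (p <= k)%N -> u k = 0) ->
      \sum_(i < p) h i (u i) = \sum_(i < q) h i (u i).
    move=> pq up; rewrite (big_ord_widen q (fun i => h i (u i)) pq).
    rewrite big_mkcond; apply: eq_bigr => i _.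
    by case: ltnP => // pi; rewrite up // linear0.
  move=> um; case/orP: (leq_total (b u) m) => bm; first exact: widen (bP u).
  by rewrite [RHS](widen _ _ bm um).
have HL : linear H.
  move=> a u v; pose m := maxn (b u) (b v).
  have um k : (m <= k)%N -> u k = 0.
    by rewrite geq_max => /andP[mk _]; apply: bP.
  have vm k : (m <= k)%N -> v k = 0.
    by rewrite geq_max => /andP[_ mk]; apply: bP.
  have uvm k : (m <= k)%N -> (a *: u + v) k = 0.
    by move=> mk; rewrite omega_sum_coordP um // vm // scaler0 addr0.
  rewrite (HE _ _ um) (HE _ _ vm) (HE _ _ uvm) scaler_sumr -big_split.
  by apply: eq_bigr => i _; rewrite omega_sum_coordP linearP.
have [H' H'E] := linear_ex HL; exists H' => k x.
rewrite H'E (HE _ k.+1) => [|i ki] /=; last first.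
  by case: eqP => // ik; rewrite ik ltnn in ki.
rewrite big_ord_recr /= eqxx big1 ?add0r // => i _.
by rewrite ltn_eqF // linear0.
Qed.

Lemma omega_lift_eq M N (f g : {linear omega_sum M -> N}) :
  (forall k x, f (omega_inj k x) = g (omega_inj k x)) -> f =1 g.
Proof.
move=> fg u; have [n ->] := omega_sum_expand u.
by rewrite !linear_sum; apply: eq_bigr => i _; apply: fg.
Qed.

Lemma projective_omega_sum M : projective M -> projective (omega_sum M).
Proof.
move=> Mproj A B g f gs.
have [h hE] := choice (fun k =>
  Mproj A B g (f \o @omega_inj M k : {linear M -> B}) gs).
have [H HE] := omega_lift h; exists H.
apply: (@omega_lift_eq M B (g \o H : {linear omega_sum M -> B})) => k x /=.
by rewrite HE hE.
Qed.

Lemma countably_generated_omega_sum M :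
  countably_generated M -> countably_generated (omega_sum M).
Proof.
move=> /countably_generated_submod[e eP].
apply: (@submod_countably_generated _ _ (nat * nat)%type
  (fun t => omega_inj t.1 (e t.2))) => A Acl Ae.
apply: omega_sum_submod => // k x.
exact: (eP _ (submod_closed_preim (@omega_inj M k) Acl) (fun i => Ae (k, i))).
Qed.

(** The two summands go to the even and to the odd coordinates. *)
Lemma omega_sum_double M :
  lmod_isom (omega_sum M * omega_sum M)%type (omega_sum M).
Proof.
have [E EE] := omega_lift (fun k => @omega_inj M k.*2).
have [O OE] := omega_lift (fun k => @omega_inj M k.*2.+1).
pose MM : lmodType R := (omega_sum M * omega_sum M)%type.
pose jl : {linear omega_sum M -> MM} := @prod_inl R (omega_sum M) (omega_sum M).
pose jr : {linear omega_sum M -> MM} := @prod_inr R (omega_sum M) (omega_sum M).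
have [G GE] := omega_lift (fun k =>
  (if odd k then jr else jl) \o @omega_inj M k./2 : {linear M -> MM}).
have [f fE] := prod_case E O.
have GEK u : G (E u) = prod_inl _ u.
  apply: (@omega_lift_eq _ _ (G \o E : {linear _ -> _})) => k x /=.
  by rewrite EE GE /= odd_double doubleK.
have GOK u : G (O u) = prod_inr _ u.
  apply: (@omega_lift_eq _ _ (G \o O : {linear _ -> _})) => k x /=.
  by rewrite OE GE /= odd_double uphalf_double.
exists f, G => [[u v]|u]; first by rewrite fE linearD GEK GOK -prod_inlr.
apply: (@omega_lift_eq _ _ (f \o G : {linear _ -> _}) idfun) => k x /=.
rewrite GE fE /= -[k in RHS]odd_double_half; case: ifP => ok.
  by rewrite linear0 add0r OE.
by rewrite linear0 addr0 EE.
Qed.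

End OmegaSum.

(** * Kernels of split surjections *)

Section Kernel.
Variables (R : pzRingType) (M N : lmodType R) (f : {linear M -> N}).

Definition kernel_pred : {pred M} := fun x => f x == 0.

Fact kernel_submod_closed : submod_closed kernel_pred.
Proof.
split=> [|a x y]; first by rewrite unfold_in linear0.
by rewrite !unfold_in linearP => /eqP-> /eqP->; rewrite scaler0 addr0.
Qed.

HB.instance Definition _ :=
  GRing.isSubmodClosed.Build R M kernel_pred kernel_submod_closed.

Record kernel := Kernel { kernel_val :> M; _ : kernel_val \in kernel_pred }.
HB.instance Definition _ := [isSub for kernel_val].
HB.instance Definition _ := [Choice of kernel by <:].
HB.instance Definition _ := [SubChoice_isSubZmodule of kernel by <:].
HB.instance Definition _ := [SubZmodule_isSubLmodule of kernel by <:].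

Lemma kernel_eq0 (x : kernel) : f (val x) = 0.
Proof. exact: eqP (valP x). Qed.

Lemma kernel_retract (s : {linear N -> M}) : (forall y, f (s y) = y) ->
  exists r : {linear M -> kernel},
    (forall x, val (r x) = x - s (f x)) /\ (forall k, r (val k) = k).
Proof.
move=> fs.
have rP x : x - s (f x) \in kernel_pred.
  by rewrite unfold_in linearB fs subrr.
have rL : linear (fun x => Kernel (rP x)).
  move=> a x y; apply: val_inj; rewrite [RHS]linearP /=.
  by rewrite !linearP /= scalerBr -scalerN addrACA.
have [r rE] := linear_ex rL; exists r; split=> x; first by rewrite rE.
by apply: val_inj; rewrite rE /= kernel_eq0 linear0 subr0.
Qed.

Lemma split_kernel_isom (s : {linear N -> M}) :
  (forall y, f (s y) = y) -> lmod_isom (N * kernel)%type M.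
Proof.
move=> fs; have [r [rE rK]] := kernel_retract fs.
have [h hE] := prod_case s (val : {linear kernel -> M}).
exists h, (fun x => (f x, r x)) => [[y k]|x]; last first.
  rewrite hE -[X in _ + X]/(val (r x)).
  by rewrite rE addrC subrK.
have rs0 : r (s y) = 0 by apply: val_inj; rewrite rE fs subrr.
by rewrite hE !linearD fs rs0 rK kernel_eq0 addr0 add0r.
Qed.

End Kernel.

(** * Dual bases and maps out of a countable sum *)

(** The coordinates of a splitting of the surjection from the free module on
    the generators. *)
Lemma dual_basis (R : pzRingType) (P : lmodType R) :
  countably_generated P -> projective P ->
  exists (e : nat -> P) (f : nat -> {linear P -> R^o}), forall x, exists n,
    x = \sum_(i < n) (f i x : R) *: e i.
Proof.
move=> [e eP] Pproj.
have hL k : linear (fun c : R^o => (c : R) *: e k).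
  by move=> a c d; rewrite scalerDl scalerA.
have [h hE] := choice (fun k => linear_ex (hL k)).
have [H HE] := omega_lift h.
have Hs x : exists u, H u = idfun x.
  have [n [c ->]] := eP x.
  exists (\sum_(i < n) omega_inj i (c i : R^o)).
  by rewrite linear_sum; apply: eq_bigr => i _; rewrite HE hE.
have [s sE] := Pproj _ _ H idfun Hs.
have fL k : linear (fun x => s x k).
  by move=> a x y; rewrite linearP.
have [f fE] := choice (fun k => linear_ex (fL k)).
exists e, f => x; have [n sx] := omega_sum_expand (s x); exists n.
rewrite -[LHS]sE sx linear_sum; apply: eq_bigr => i _.
by rewrite HE hE fE.
Qed.

(** Countably many maps out of P^w have their images inside the image of a
    single one, because the countable sum of copies of P^w is again P^w: the
    pair [(n, i)], coded as a natural number, is the place where the [i]-th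
    summand of the [n]-th copy goes. *)
Lemma omega_sum_join (R : pzRingType) (P M : lmodType R)
    (H : nat -> {linear omega_sum P -> M}) :
  exists G : {linear omega_sum P -> M}, forall n u, exists v, G v = H n u.
Proof.
pose t k : nat * nat := odflt (0, 0)%N (unpickle k).
have [G GE] := omega_lift (fun k =>
  H (t k).1 \o @omega_inj R P (t k).2 : {linear P -> M}).
exists G => n.
have [J JE] := omega_lift (fun k => @omega_inj R P (pickle (n, k))).
move=> u; exists (J u); move: u.
apply: (@omega_lift_eq _ _ _ (G \o J : {linear omega_sum P -> M})) => k x /=.
by rewrite JE GE /= /t pickleK.
Qed.

(** * Reduction modulo an ideal *)

Section Reduction.
Variables (S : pzRingType) (I : ideal S).
Implicit Types (M N : rmodType S) (Z : rmodType (ring_quot I)).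

(** Restriction of scalars along S -> S/I.  The alias allows maps from
    S-modules to S/I-modules to be S-linear, and so to be lifted by the
    projectivity of their source. *)
Definition restrict Z : Type := Z.
HB.instance Definition _ Z := GRing.Zmodule.on (restrict Z).

Definition restrict_scale Z (a : S^c) (z : restrict Z) : restrict Z :=
  (\pi_(ring_quot I) (a : S) : (ring_quot I)^c) *: (z : Z).

Fact restrict_scaleA Z (a b : S^c) (z : restrict Z) :
  restrict_scale a (restrict_scale b z) = restrict_scale (a * b) z.
Proof.
rewrite /restrict_scale scalerA; congr (_ *: (z : Z)).
exact/esym/(ring_quot_piM I (b : S) (a : S)).
Qed.

Fact restrict_scale1 Z : left_id 1 (@restrict_scale Z).
Proof. by move=> z; apply: (scale1r (z : Z)). Qed.

Fact restrict_scaleDr Z : right_distributive (@restrict_scale Z) +%R.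
Proof. by move=> a x y; apply: scalerDr. Qed.

Fact restrict_scaleDl Z (z : restrict Z) :
  {morph (@restrict_scale Z)^~ z : a b / a + b}.
Proof.
move=> a b; rewrite /restrict_scale -scalerDl; congr (_ *: (z : Z)).
exact: (ring_quot_piD I (a : S) (b : S)).
Qed.

HB.instance Definition _ Z := GRing.Zmodule_isLmodule.Build S^c (restrict Z)
  (@restrict_scaleA Z) (@restrict_scale1 Z)
  (@restrict_scaleDr Z) (@restrict_scaleDl Z).

Lemma restrict_linear Z Z' (f : {linear Z -> Z'}) :
  exists g : {linear restrict Z -> restrict Z'}, forall z, g z = f z.
Proof.
have fL : linear (f : restrict Z -> restrict Z').
  by move=> a x y; apply: linearP.
by have [g gE] := linear_ex fL; exists g.
Qed.

(** MI is the least submodule containing the products of elements of I and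
    elements of M. *)
Lemma mod_mul_ideal_min M (A : {pred M}) : submod_closed A ->
  (forall a x, a \in ideal_pred I -> (a : S^c) *: x \in A) ->
  forall x, x \in mod_mul_ideal I (Q:=M) -> x \in A.
Proof.
move=> [A0 AD] AI x /asboolP[n [q [a [aI ->]]]].
elim: n q a aI => [|n IH] q a aI; first by rewrite big_ord0.
rewrite big_ord_recr /= -[X in X + _]scale1r; apply: AD; last exact: AI.
exact: (IH (fun i => q (widen_ord (leqnSn n) i)) (fun i => a (widen_ord _ i))).
Qed.

Lemma mod_mul_ideal_linear M N (f : {linear M -> N}) x :
  x \in mod_mul_ideal I (Q:=M) -> f x \in mod_mul_ideal I (Q:=N).
Proof.
apply: (mod_mul_ideal_min
  (submod_closed_preim f (mod_mul_ideal_submod I N))) => a {}x aI.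
by rewrite inE linearZ mod_mul_idealZ.
Qed.

Lemma mod_mul_ideal_pair M N (x : M) (y : N) :
  x \in mod_mul_ideal I (Q:=M) -> y \in mod_mul_ideal I (Q:=N) ->
  (x, y) \in mod_mul_ideal I (Q:=(M * N)%type).
Proof.
move=> xI yI; rewrite prod_inlr.
by apply: (@rpredD _ (mod_mul_ideal I (Q:=_))); apply: mod_mul_ideal_linear.
Qed.

Lemma restrict_kills M Z (t : {linear M -> restrict Z}) x :
  x \in mod_mul_ideal I (Q:=M) -> t x = 0.
Proof.
move=> xI; apply/eqP; move: x xI.
apply: (mod_mul_ideal_min (A := kernel_pred t)).
  exact: kernel_submod_closed.
move=> a x aI; rewrite unfold_in linearZ; apply/eqP.
have a0 : \pi_(ring_quot I) a = 0.
  rewrite -[RHS](raddf0 (\pi_(ring_quot I) : {additive S -> ring_quot I})).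
  by apply/ring_quot_eqP; rewrite subr0.
transitivity ((0 : (ring_quot I)^c) *: (t x : Z)); last exact: (@scale0r _ Z).
exact: (congr1 (fun b : (ring_quot I)^c => b *: (t x : Z)) a0).
Qed.

(** The kernel of [t] contains MI in any case, by [restrict_kills]. *)
Definition is_reduction M Z (t : {linear M -> restrict Z}) :=
  (forall z : Z, exists x, t x = z) /\
  (forall x, t x = 0 -> x \in mod_mul_ideal I (Q:=M)).

(** The isomorphism sends [t x] to [t' x]; this makes sense and is injective
    because [t] and [t'] have the same kernel.  It is linear over S/I because
    every scalar of S/I comes from S. *)
Lemma reduction_unique M Z Z' (t : {linear M -> restrict Z})
    (t' : {linear M -> restrict Z'}) :
  is_reduction t -> is_reduction t' -> lmod_isom Z Z'.
Proof.
move=> [ts tI] [t's t'I]; have [r rE] := choice ts.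
have tt' x y : t x = t y -> t' x = t' y.
  move=> txy; apply/eqP; rewrite -subr_eq0 -linearB.
  apply/eqP/restrict_kills/tI.
  by rewrite linearB txy subrr.
have fL : linear (fun z : Z => t' (r z) : Z').
  elim/(@quotW _ (ring_quot I)) => a x y.
  transitivity (t' ((a : S^c) *: r x + r y)); last exact: linearP.
  by apply: tt'; rewrite rE linearP !rE.
have [f fE] := linear_ex fL.
apply: (inj_surj_lmod_isom (f := f)) => [z|z'].
  by rewrite fE => /t'I/(restrict_kills t) <-; exact/esym/rE.
have [x tx] := t's z'; exists (t x); rewrite fE -tx.
by apply: tt'; exact: rE.
Qed.

Lemma mod_quot_reduction M :
  exists t : {linear M -> restrict (mod_quot I M)},
    is_reduction t.
Proof.
have pL : linear (\pi_(mod_quot I M) : M -> restrict (mod_quot I M)).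
  move=> a x y; rewrite mod_quot_piD; congr (_ + _).
  exact/esym/mod_quot_scale_pi.
have [t tE] := linear_ex pL; exists t; split=> [z|x].
  by exists (repr z); rewrite tE reprK.
rewrite tE -(raddf0 (\pi_(mod_quot I M) : {additive M -> mod_quot I M})).
by move=> /mod_quot_eqP; rewrite subr0.
Qed.

Lemma reduction_isom M Z Z' (t : {linear M -> restrict Z}) :
  is_reduction t -> lmod_isom Z Z' ->
  exists t' : {linear M -> restrict Z'}, is_reduction t'.
Proof.
move=> [ts tI] [f [g fK gK]]; have [f' f'E] := restrict_linear f.
exists (f' \o t : {linear M -> restrict Z'}); split=> [z|x] /=.
  by have [x tx] := ts (g z); exists x; rewrite f'E tx gK.
rewrite f'E => ftx; apply: tI; apply: (can_inj fK).
by rewrite ftx; exact/esym/(linear0 f).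
Qed.

Lemma reduction_precomp M N Z (t : {linear M -> restrict Z}) :
  is_reduction t -> lmod_isom N M ->
  exists t' : {linear N -> restrict Z}, is_reduction t'.
Proof.
move=> [ts tI] [h [k hK kK]]; have [k' k'E] := linear_inverse hK kK.
exists (t \o h : {linear N -> restrict Z}); split=> [z|x] /=.
  by have [x tx] := ts z; exists (k x); rewrite kK.
by move=> /tI/(mod_mul_ideal_linear k'); rewrite k'E hK.
Qed.

Lemma reduction_prod M N Z Z' (t : {linear M -> restrict Z})
    (t' : {linear N -> restrict Z'}) :
  is_reduction t -> is_reduction t' ->
  exists u : {linear (M * N)%type -> restrict (Z * Z')%type}, is_reduction u.
Proof.
move=> [ts tI] [t's t'I].
have uL : linear (fun x : M * N => (t x.1, t' x.2) : restrict (Z * Z')%type).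
  by move=> a x y; rewrite !linearP.
have [u uE] := linear_ex uL; exists u; split=> [[z z']|[x y]].
  have [x tx] := ts z; have [y ty] := t's z'.
  by exists (x, y); rewrite uE /= tx ty.
by rewrite uE /= => -[/tI xI /t'I yI]; apply: mod_mul_ideal_pair.
Qed.

Lemma reduction_absorb M N Z (t : {linear M -> restrict Z}) :
  (forall y : N, y \in mod_mul_ideal I (Q:=N)) -> is_reduction t ->
  is_reduction (t \o fst : {linear (M * N)%type -> restrict Z}).
Proof.
move=> NI [ts tI]; split=> [z|[x y]] /=.
  by have [x tx] := ts z; exists (x, 0).
by move=> /tI xI; apply: mod_mul_ideal_pair.
Qed.

(** Splitting makes reduction exact.  If [u x = (0, z)] then [G x] lies in NI,
    so replacing [x] by its projection [x - s (G x)] to the kernel changes it by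
    an element of MI, which [u] does not see; hence surjectivity.  An element of
    the kernel killed by [u] lies in MI, and the projection carries MI into the
    kernel times I. *)
Lemma reduction_kernel M N Z Z' (G : {linear M -> N}) (s : {linear N -> M})
    (t : {linear N -> restrict Z})
    (u : {linear M -> restrict (Z * Z')%type}) :
  (forall y, G (s y) = y) -> is_reduction t -> is_reduction u ->
  (forall x, (u x).1 = t (G x)) ->
  exists v : {linear kernel G -> restrict Z'}, is_reduction v.
Proof.
move=> Gs [_ tI] [us uI] utG; have [r [rE rK]] := kernel_retract Gs.
have vL : linear (fun k : kernel G => (u (val k)).2 : restrict Z').
  by move=> a k l; rewrite !linearP.
have [v vE] := linear_ex vL; exists v; split=> [z|k].
  have [x ux] := us (0, z); exists (r x); rewrite vE rE.
  rewrite linearB (restrict_kills u (x := s (G x))) ?subr0 ?ux //.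
  by apply/mod_mul_ideal_linear/tI; rewrite -utG ux.
rewrite vE => uk2; rewrite -(rK k); apply/mod_mul_ideal_linear/uI.
by rewrite [LHS]surjective_pairing uk2 utG kernel_eq0 linear0.
Qed.

End Reduction.

(** * The trace ideal of a projective module *)

Section Trace.
Variables (S : pzRingType) (P : rmodType S).
Implicit Types M : rmodType S.
Let I := trace_ideal P.

(** P = PI: the coefficients in the expansion of [x] on a dual basis are values
    of functionals on P, hence lie in the trace ideal. *)
Lemma trace_mul_self : countably_generated P -> projective P ->
  forall x : P, x \in mod_mul_ideal I (Q:=P).
Proof.
move=> Pcg Pproj x; have [e [f ef]] := dual_basis Pcg Pproj.
have [n ->] := ef x; apply/asboolP; exists n, e, (fun i => f i x).
split=> // i; apply/asboolP; exists 1%N, (fun=> f i), (fun=> x).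
by rewrite big_ord1.
Qed.

Lemma trace_mul_omega_sum : countably_generated P -> projective P ->
  forall u : omega_sum P, u \in mod_mul_ideal I (Q:=omega_sum P).
Proof.
move=> Pcg Pproj; apply: omega_sum_submod; first exact: mod_mul_ideal_submod.
by move=> k x; apply: mod_mul_ideal_linear; apply: trace_mul_self.
Qed.

(** For a functional [f] on P, the product of [f p] and [x] is the value at [p]
    of the linear map [q |-> f q *: x]; sums of such values are collected by
    [omega_sum_join]. *)
Lemma trace_mul_image M (x : M) : x \in mod_mul_ideal I (Q:=M) ->
  exists (H : {linear omega_sum P -> M}) (u : omega_sum P), H u = x.
Proof.
pose A : {pred M} := fun y => `[< exists (H : {linear omega_sum P -> M})
  (u : omega_sum P), H u = y >].
have Acl : submod_closed A.
  split; first by apply/asboolP; exists \0, 0.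
  move=> a y z /asboolP[H [u <-]] /asboolP[H' [v <-]]; apply/asboolP.
  have [G GE] := omega_sum_join (fun n => if n is 0%N then H else H').
  have [u' u'E] := GE 0%N u; have [v' v'E] := GE 1%N v.
  by exists G, (a *: u' + v'); rewrite linearP u'E v'E.
move=> xI; apply/asboolP; move: x xI; apply: (mod_mul_ideal_min Acl).
move=> a x /asboolP[n [f [p ->]]].
have -> : ((\sum_(i < n) f i (p i) : S) : S^c) *: x
    = \sum_(i < n) (f i (p i) : S^c) *: x by rewrite scaler_suml.
case: Acl => A0 AD.
apply: (big_ind (fun y => y \in A)) => // [y z Ay Az|i _].
  by rewrite -[y]scale1r; apply: AD.
have hL : linear (fun q : P => (f i q : S^c) *: x).
  by move=> b q q'; rewrite linearP scalerDl scalerA.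
have [h hE] := linear_ex hL; have [H HE] := omega_lift (fun=> h).
by apply/asboolP; exists H, (omega_inj 0 (p i)); rewrite HE hE.
Qed.

(** It suffices to reach the countably many generators of M, and each of them
    needs one map P^w -> M to correct the error in MI that [g] leaves. *)
Lemma trace_cover M N (g : {linear N -> M}) : countably_generated M ->
  (forall x, exists y, x - g y \in mod_mul_ideal I (Q:=M)) ->
  exists H : {linear omega_sum P -> M}, forall x, exists y u, g y + H u = x.
Proof.
move=> /countably_generated_submod[e eP] gI.
have /choice[H He] n : exists H : {linear omega_sum P -> M},
    exists y u, g y + H u = e n.
  have [y /trace_mul_image[H [u Hu]]] := gI (e n).
  by exists H, y, u; rewrite Hu addrC subrK.
have [G GE] := omega_sum_join H; exists G => x; apply/asboolP; move: x.
apply: eP => [|n]; last first.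
  have [y [u <-]] := He n; have [v vE] := GE n u.
  by apply/asboolP; exists y, v; rewrite vE.
split; first by apply/asboolP; exists 0, 0; rewrite !linear0 addr0.
move=> a _ _ /asboolP[y [u <-]] /asboolP[z [v <-]]; apply/asboolP.
by exists (a *: y + z), (a *: u + v); rewrite !linearP scalerDr addrACA.
Qed.

End Trace.

(** * Lifting a complement *)

(** The complement Y of Q1/Q1I in Q2/Q2I lifts to the kernel of a split
    surjection from the sum of Q2 and P^w onto Q1.  Without P^w the lift
    [g : Q2 -> Q1] is onto only modulo Q1I. *)
Lemma complement_lift (S : pzRingType) (P Q1 Q2 : rmodType S)
    (Y : rmodType (ring_quot (trace_ideal P))) :
  countably_generated P -> projective P ->
  countably_generated Q1 -> projective Q1 ->
  countably_generated Q2 -> projective Q2 ->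
  lmod_isom (mod_quot (trace_ideal P) Q1 * Y)%type
            (mod_quot (trace_ideal P) Q2) ->
  exists P' : rmodType S,
    [/\ countably_generated P', projective P',
        lmod_isom (mod_quot (trace_ideal P) P') Y &
        lmod_isom (Q1 * P')%type (Q2 * omega_sum P)%type].
Proof.
move=> Pcg Pproj Q1cg Q1proj Q2cg Q2proj iso.
have PwI := trace_mul_omega_sum Pcg Pproj.
have [t1 t1P] := mod_quot_reduction (trace_ideal P) Q1.
have [t2 t2P] := mod_quot_reduction (trace_ideal P) Q2.
have [t tP] := reduction_isom t2P (lmod_isom_sym iso).
have fL : linear (fun x : Q2 => (t x).1 : restrict (mod_quot _ Q1)).
  by move=> a x y; rewrite linearP.
have [f fE] := linear_ex fL.
have [g gE] := Q2proj _ _ t1 f t1P.1.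
have [H HE] : exists H : {linear omega_sum P -> Q1},
    forall x, exists y u, g y + H u = x.
  apply: trace_cover => // x; have [y ty] := tP.1 (t1 x, 0).
  by exists y; apply: t1P.2; rewrite linearB gE fE ty subrr.
have [G GE] := prod_case g H.
have Gs x : exists m, G m = idfun x.
  by have [y [u yu]] := HE x; exists (y, u); rewrite GE.
have [s sE] := Q1proj _ _ G idfun Gs.
have [r [_ rK]] := kernel_retract sE.
exists (kernel G); split.
- apply: (countably_generated_image (f := r)).
    by move=> k; exists (val k); exact: rK.
  exact: countably_generated_prod Q2cg (countably_generated_omega_sum Pcg).
- apply: (projective_retract (i := (val : {linear kernel G -> _})) rK).
  exact: projective_prod Q2proj (projective_omega_sum Pproj).
- have [t' t'P] := mod_quot_reduction (trace_ideal P) (kernel G).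
  have [|v vP] := reduction_kernel sE t1P (reduction_absorb PwI tP).
    move=> x; rewrite GE linearD gE fE.
    by rewrite (restrict_kills t1 (mod_mul_ideal_linear H (PwI _))) addr0.
  exact: reduction_unique t'P vP.
- exact: split_kernel_isom sE.
Qed.

Theorem corollary2p12 (S : pzRingType) (P Q1 Q2 : rmodType S)
    (Y : rmodType (ring_quot (trace_ideal P))) :
  countably_generated P -> projective P ->
  countably_generated Q1 -> projective Q1 ->
  countably_generated Q2 -> projective Q2 ->
  lmod_isom (mod_quot (trace_ideal P) Q1 * Y)%type
            (mod_quot (trace_ideal P) Q2)
  <->
  exists P' : rmodType S,
    [/\ countably_generated P', projective P',
        lmod_isom (mod_quot (trace_ideal P) P') Y &
        lmod_isom (Q1 * P' * omega_sum P)%type (Q2 * omega_sum P)%type].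
Proof.
move=> Pcg Pproj Q1cg Q1proj Q2cg Q2proj.
split=> [iso|[P' [P'cg P'proj P'Y iso]]].
  have [P' [P'cg P'proj P'Y sum]] :=
    complement_lift Pcg Pproj Q1cg Q1proj Q2cg Q2proj iso.
  exists P'; split=> //.
  apply: lmod_isom_trans (lmod_isom_prod sum (lmod_isom_refl _)) _.
  apply: lmod_isom_trans (lmod_isom_prodA _ _ _) _.
  exact: lmod_isom_prod (lmod_isom_refl _) (omega_sum_double _).
(* Both Q1/Q1I + Y and Q2/Q2I are reductions of Q1 + P' + P^w. *)
have PwI := trace_mul_omega_sum Pcg Pproj.
have [t1 t1P] := mod_quot_reduction (trace_ideal P) Q1.
have [t2 t2P] := mod_quot_reduction (trace_ideal P) Q2.
have [t' t'P] := mod_quot_reduction (trace_ideal P) P'.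
have [tY tYP] := reduction_isom t'P P'Y.
have [u uP] := reduction_prod t1P tYP.
have [v vP] := reduction_precomp (reduction_absorb PwI t2P) iso.
exact: reduction_unique (reduction_absorb PwI uP) vP.
Qed.
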